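(* Let $K$ be a field, let $r\ge 1$ be an integer, and let $G$ be a finite simple graph with nonempty vertex set. Suppose that $G$ is $r$-partite, that $G$ belongs to the class $\mathcal{G}$ (i.e. the vertices of $G$ can be covered by $\alpha(G)$ cliques of $G$), and that all maximal cliques of $G$ have size $r$. If $G$ is Cohen-Macaulay (over $K$), then there is a unique perfect $r$-matching in $G$.
   Context: All graphs are finite, undirected, without loops or multiple edges. An independent set is a set of pairwise nonadjacent vertices, and $\alpha(G)$ is the maximum cardinality of an independent set of vertices of $G$. A clique is a set of pairwise adjacent vertices; maximal cliques are maximal with respect to inclusion; an $r$-clique is a clique of size $r$. An $r$-matching in $G$ is a set of pairwise disjoint $r$-cliques of $G$, and a perfect $r$-matching is an $r$-matching which covers all vertices of $G$. $G$ is $r$-partite if its vertex set can be partitioned into $r$ disjoint independent sets. $\mathcal{G}$ denotes the class of graphs $G$ such that there are $k=\alpha(G)$ cliques $Q_1,\dots,Q_k$ in $G$ with $V(Q_1)\cup\cdots\cup V(Q_k)=V(G)$. For a graph $G$ on the vertex set $[n]=\{1,\dots,n\}$ and a field $K$, let $S=K[x_1,\dots,x_n]$; the edge ideal $I(G)\subset S$ is generated by all monomials $x_ix_j$ with $i$ adjacent to $j$ in $G$, and $R(G)=S/I(G)$ is the edge ring of $G$. The graph $G$ is called Cohen-Macaulay (over $K$) if the ring $R(G)$ is Cohen-Macaulay in the usual sense. *)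

(* Defs.v *)
From HB Require Import structures.
From mathcomp Require Import all_boot all_order all_algebra.
From mathcomp Require Import ring_quotient generic_quotient.
From mathcomp Require Import boolp.
From mathcomp Require Import ring.

Set Implicit Arguments.
Unset Strict Implicit.
Unset Printing Implicit Defensive.

Import GRing.Theory.
Local Open Scope ring_scope.
Local Open Scope quotient_scope.

Record sgraph := SGraph {
  vertex :> finType;
  adj : rel vertex;
  adj_sym : symmetric adj;
  adj_irrefl : irreflexive adj }.

Section Graphs.
Variable G : sgraph.

Definition independent (A : {set G}) : bool :=
  [forall x in A, forall y in A, ~~ adj x y].

Definition alpha : nat := \max_(A : {set G} | independent A) #|A|.

Definition clique (A : {set G}) : bool :=
  [forall x in A, forall y in A, (x != y) ==> adj x y].

Definition maximal_clique (A : {set G}) : bool := maxset clique A.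

Definition rclique (r : nat) (A : {set G}) : bool := clique A && (#|A| == r).

(* [trivIset M] says that distinct members of [M] are disjoint. *)
Definition rmatching (r : nat) (M : {set {set G}}) : bool :=
  trivIset M && [forall A in M, rclique r A].

Definition perfect_rmatching (r : nat) (M : {set {set G}}) : bool :=
  rmatching r M && (cover M == [set: G]).

(* Parts are allowed to be empty. *)
Definition rpartite (r : nat) : Prop :=
  exists V : 'I_r -> {set G},
    [/\ forall i, independent (V i),
        forall i j, i != j -> [disjoint V i & V j]
      & \bigcup_i V i = [set: G]].

Definition class_G : Prop :=
  exists Q : 'I_alpha -> {set G},
    (forall i, clique (Q i)) /\ \bigcup_i Q i = [set: G].

End Graphs.

(* In [ring_quotient], [idealr_closed I] says that [I] is a proper ideal. *)
Section Ideals.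
Variable R : comNzRingType.

Definition ideal_span (s : seq R) (x : R) : Prop :=
  exists c : 'I_(size s) -> R, x = \sum_i c i * s`_i.

(* The unit ideal is spanned by [1], so only proper ideals are tested. *)
Definition noetherian : Prop :=
  forall I : {pred R}, idealr_closed I ->
    exists s : seq R, forall x, x \in I <-> ideal_span s x.

Definition prime_ideal (I : {pred R}) : Prop :=
  idealr_closed I /\ prime_idealr_closed I.

Definition maximal_ideal (I : {pred R}) : Prop :=
  idealr_closed I /\
  forall J : {pred R}, idealr_closed J -> {subset I <= J} -> {subset J <= I}.

Definition prime_chain (d : nat) : Prop :=
  exists P : 'I_d.+1 -> {pred R},
    (forall i, prime_ideal (P i)) /\
    (forall i j : 'I_d.+1, (i < j)%N ->
       {subset P i <= P j} /\ ~ {subset P j <= P i}).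

Definition krull_dim_is (d : nat) : Prop :=
  prime_chain d /\ forall e, prime_chain e -> (e <= d)%N.

Definition regular_seq (s : seq R) : Prop :=
  (forall i, (i < size s)%N -> forall a : R,
     ideal_span (take i s) (s`_i * a) -> ideal_span (take i s) a) /\
  ~ ideal_span s 1.

Definition regular_seq_in (I : {pred R}) (d : nat) : Prop :=
  exists s : seq R, [/\ size s = d, {subset s <= I} & regular_seq s].

Definition depth_is (I : {pred R}) (d : nat) : Prop :=
  regular_seq_in I d /\ forall e, regular_seq_in I e -> (e <= d)%N.

(* [depth_is] is only used for the maximal ideal [M] of a local ring; uniqueness
   of [M] is the statement that the ring is local. *)
Definition local_cohen_macaulay : Prop :=
  noetherian /\
  exists M : {pred R},
    [/\ maximal_ideal M,
        forall N : {pred R}, maximal_ideal N -> N =i M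
      & exists d, depth_is M d /\ krull_dim_is d].

End Ideals.

(* The localization of [R] at a prime ideal [p]: fractions [a / s] with [s]
   outside [p], where [a / s = b / t] iff [u * (a * t - b * s) = 0] for some
   [u] outside [p]. *)
Module Localization.
Section Localization.
Variables (R : comNzRingType) (p : prime_idealr R).

Record pre := Pre { frac : R * R; frac_den : frac.2 \notin (p : {pred R}) }.

#[export]
HB.instance Definition _ := [isSub for frac].
#[export]
HB.instance Definition _ := [Choice of pre by <:].

Local Notation num x := (frac x).1.
Local Notation den x := (frac x).2.

Lemma one_notin : 1 \notin (p : {pred R}).
Proof. by rewrite idealr1. Qed.

Lemma mul_notin s t :
  s \notin (p : {pred R}) -> t \notin (p : {pred R}) ->
  s * t \notin (p : {pred R}).
Proof. by move=> hs ht; rewrite prime_idealrM negb_or hs. Qed.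

Definition equiv (x y : pre) : bool :=
  `[< exists2 u, u \notin (p : {pred R})
               & u * (num x * den y - num y * den x) = 0 >].

Lemma equivP x y :
  reflect (exists2 u, u \notin (p : {pred R})
                    & u * (num x * den y) = u * (num y * den x)) (equiv x y).
Proof.
apply: (iffP (asboolP _)) => -[u hu E]; exists u => //.
  by apply/eqP; rewrite -subr_eq0 -mulrBr E.
by rewrite mulrBr E subrr.
Qed.

Lemma equiv_refl : reflexive equiv.
Proof. by move=> x; apply/equivP; exists 1; rewrite ?one_notin. Qed.

Lemma equiv_sym : symmetric equiv.
Proof.
by move=> x y; apply/equivP/equivP => -[u hu E]; exists u.
Qed.

Lemma equiv_trans : transitive equiv.
Proof.
move=> y x z /equivP[u hu E] /equivP[v hv F]; apply/equivP.
exists (u * v * den y); first by rewrite !mul_notin ?frac_den.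
rewrite (_ : _ * _ = v * den z * (u * (num x * den y))); last by ring.
rewrite E (_ : _ * _ = u * den x * (v * (num y * den z))); last by ring.
by rewrite F; ring.
Qed.

Canonical equiv_equiv := EquivRel equiv equiv_refl equiv_sym equiv_trans.

Definition type := {eq_quot equiv}.

#[export]
HB.instance Definition _ : EqQuotient _ equiv type := EqQuotient.on type.
#[export]
HB.instance Definition _ := Choice.on type.

Definition mkfrac (a s : R) (hs : s \notin (p : {pred R})) : type :=
  \pi_type (@Pre (a, s) hs).

Lemma mkfrac_eq a s hs b t ht :
  @mkfrac a s hs = @mkfrac b t ht <->
  exists2 u, u \notin (p : {pred R}) & u * (a * t - b * s) = 0.
Proof.
split=> [/eqmodP /asboolP //|h]; apply/eqmodP/asboolP; exact: h.
Qed.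

Lemma mkfrac_surj (z : type) : exists a s hs, z = @mkfrac a s hs.
Proof.
elim/quotW: z => -[[a s] hs]; by exists a, s, hs.
Qed.

Local Notation zeroq := (mkfrac 0 one_notin).
Local Notation oneq := (mkfrac 1 one_notin).

Definition pre_add (x y : pre) : pre :=
  @Pre (num x * den y + num y * den x, den x * den y)
    (mul_notin (frac_den x) (frac_den y)).
Definition pre_opp (x : pre) : pre := @Pre (- num x, den x) (frac_den x).
Definition pre_mul (x y : pre) : pre :=
  @Pre (num x * num y, den x * den y)
    (mul_notin (frac_den x) (frac_den y)).

Definition add := lift_op2 type pre_add.
Definition opp := lift_op1 type pre_opp.
Definition mul := lift_op2 type pre_mul.

Lemma repr_equiv x : equiv x (repr (\pi_type x)).
Proof. by apply/eqmodP; rewrite reprK. Qed.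

Lemma pi_add : {morph \pi : x y / pre_add x y >-> add x y}.
Proof.
move=> x y; unlock add; apply/eqmodP/equivP => /=.
have /equivP[u hu E] := repr_equiv x; have /equivP[v hv F] := repr_equiv y.
set x' := repr _ in E *; set y' := repr _ in F *.
exists (u * v); first exact: mul_notin.
transitivity (v * den y * den y' * (u * (num x * den x'))
  + u * den x * den x' * (v * (num y * den y'))); first by ring.
by rewrite E F; ring.
Qed.
Canonical pi_add_morph := PiMorph2 pi_add.

Lemma pi_opp : {morph \pi : x / pre_opp x >-> opp x}.
Proof.
move=> x; unlock opp; apply/eqmodP/equivP => /=.
have /equivP[u hu E] := repr_equiv x; exists u => //.
by rewrite !mulNr !mulrN E.
Qed.
Canonical pi_opp_morph := PiMorph1 pi_opp.

Lemma pi_mul : {morph \pi : x y / pre_mul x y >-> mul x y}.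
Proof.
move=> x y; unlock mul; apply/eqmodP/equivP => /=.
have /equivP[u hu E] := repr_equiv x; have /equivP[v hv F] := repr_equiv y.
set x' := repr _ in E *; set y' := repr _ in F *.
exists (u * v); first exact: mul_notin.
transitivity ((u * (num x * den x')) * (v * (num y * den y'))); first by ring.
by rewrite E F; ring.
Qed.
Canonical pi_mul_morph := PiMorph2 pi_mul.

Lemma addA : associative add.
Proof.
elim/quotW=> x; elim/quotW=> y; elim/quotW=> z; rewrite !piE.
by apply/eqmodP/equivP; exists 1; rewrite ?one_notin //=; ring.
Qed.

Lemma addC : commutative add.
Proof.
elim/quotW=> x; elim/quotW=> y; rewrite !piE.
by apply/eqmodP/equivP; exists 1; rewrite ?one_notin //=; ring.
Qed.

Lemma add0 : left_id zeroq add.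
Proof.
elim/quotW=> x; rewrite /mkfrac !piE.
by apply/eqmodP/equivP; exists 1; rewrite ?one_notin //=; ring.
Qed.

Lemma addN : left_inverse zeroq opp add.
Proof.
elim/quotW=> x; rewrite /mkfrac !piE.
by apply/eqmodP/equivP; exists 1; rewrite ?one_notin //=; ring.
Qed.

#[export]
HB.instance Definition _ := GRing.isZmodule.Build type addA addC add0 addN.

Lemma mulA : associative mul.
Proof.
elim/quotW=> x; elim/quotW=> y; elim/quotW=> z; rewrite !piE.
by apply/eqmodP/equivP; exists 1; rewrite ?one_notin //=; ring.
Qed.

Lemma mulC : commutative mul.
Proof.
elim/quotW=> x; elim/quotW=> y; rewrite !piE.
by apply/eqmodP/equivP; exists 1; rewrite ?one_notin //=; ring.
Qed.

Lemma mul1 : left_id oneq mul.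
Proof.
elim/quotW=> x; rewrite /mkfrac !piE.
by apply/eqmodP/equivP; exists 1; rewrite ?one_notin //=; ring.
Qed.

Lemma mulDl : left_distributive mul add.
Proof.
elim/quotW=> x; elim/quotW=> y; elim/quotW=> z; rewrite !piE.
by apply/eqmodP/equivP; exists 1; rewrite ?one_notin //=; ring.
Qed.

Lemma nonzero1 : oneq != zeroq.
Proof.
apply/eqP => /mkfrac_eq[u hu]; rewrite mul0r subr0 !mulr1 => u0.
by move: hu; rewrite u0 idealr0.
Qed.

#[export]
HB.instance Definition _ :=
  GRing.Zmodule_isComNzRing.Build type mulA mulC mul1 mulDl nonzero1.

End Localization.
Module Exports. HB.reexport. End Exports.
End Localization.
Export Localization.Exports.

Notation "{ 'localization' p }" := (@Localization.type _ p)
  (format "{ 'localization'  p }") : type_scope.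

Definition cohen_macaulay (R : comNzRingType) : Prop :=
  noetherian R /\
  forall m : prime_idealr R, maximal_ideal (m : {pred R}) ->
    local_cohen_macaulay {localization m}.

(* Imported only here because [mpoly] shadows [symmetric]. *)
From mathcomp Require Import mpoly.

Section EdgeRing.
Variables (K : fieldType) (G : sgraph).

(* Variables of [{mpoly K[n]}] are indexed by ['I_n]: the vertices of [G] are
   numbered through [enum_rank]. *)
Definition vertex_var (v : G) : {mpoly K[#|G|]} := 'X_(enum_rank v).

Definition edge_monomials : seq {mpoly K[#|G|]} :=
  [seq vertex_var e.1 * vertex_var e.2 | e <- enum [pred e : G * G | adj e.1 e.2]].

Definition edge_ideal : {pred {mpoly K[#|G|]}} :=
  fun f => `[< ideal_span edge_monomials f >].

Lemma edge_ideal_closed : idealr_closed edge_ideal.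
Proof.
split.
- by apply/asboolP; exists (fun=> 0); rewrite big1 // => i _; rewrite mul0r.
- apply/asboolP => -[c /(congr1 (fun f => f.@[fun=> 0]))].
  rewrite rmorph1 rmorph_sum /= big1 => [/eqP|i _]; first by rewrite oner_eq0.
  have /mapP[e _ ->] : edge_monomials`_i \in edge_monomials by rewrite mem_nth.
  by rewrite !rmorphM /= mevalXU mul0r mulr0.
- move=> a f g /asboolP[c ->] /asboolP[d ->]; apply/asboolP.
  exists (fun i => a * c i + d i); rewrite mulr_sumr -big_split /=.
  by apply: eq_bigr => i _; rewrite mulrDl mulrA.
Qed.

HB.instance Definition _ :=
  isIdealr.Build {mpoly K[#|G|]} edge_ideal edge_ideal_closed.

Definition edge_ring : comNzRingType := {ideal_quot edge_ideal}.

Definition cohen_macaulay_graph : Prop := cohen_macaulay edge_ring.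

End EdgeRing.

(* Main.v *)
(** Write [Delta] for the independence complex of [G] and [k] for [alpha G].

A Cohen-Macaulay [Delta] is connected in codimension one: if its facets are
split into two nonempty classes, some facet of the first meets some facet of the
second in at least [k - 1] vertices.  Otherwise the monomials supported on no
facet of the first (second) class generate an ideal [I] ([J]) of the edge ring
with [I J = 0], and the edge ring modulo [I + J] has dimension at most [k - 2].
As the local ring at the origin has depth at least [k], [I + J] has grade at
least 2 there, so the projection [I + J -> I] is the multiplication by a ring
element [e].  In a local ring [e] or [1 - e] is a unit, hence [J = 0] or
[I = 0], which is absurd.  Grade is measured by the vanishing of Koszul
cohomology.

Connectedness in codimension one forces all facets to have [k] vertices.  The
parts [V_i] meet every maximal clique, so they are facets and [#|G| = k r]; hence
maximal cliques containing [Q_1, ..., Q_k] must be disjoint.  A perfect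
[r]-matching is a colouring of the vertices in which every facet has exactly one
vertex of each colour; passing to a facet that differs in one vertex, the new
vertex gets the colour of the old one, so two matchings that induce matched
colourings on one facet do so on all of them. *)

From HB Require Import structures.
Require Import Defs.
From mathcomp Require Import all_boot all_algebra.
From mathcomp Require Import ring_quotient generic_quotient boolp ring mpoly zify.

Set Implicit Arguments.
Unset Strict Implicit.
Unset Printing Implicit Defensive.

Section CommutativeAlgebra.
Import GRing.Theory.
Local Open Scope ring_scope.
Variable A : comNzRingType.

Definition submodule (M : lmodType A) (N : M -> Prop) : Prop :=
  N 0 /\ forall a x y, N x -> N y -> N (a *: x + y).

Section Submodule.
Variables (M : lmodType A) (N : M -> Prop).
Hypothesis subN : submodule N.

Lemma submoduleD x y : N x -> N y -> N (x + y).
Proof. by move=> Nx Ny; rewrite -[x]scale1r; apply: subN.2. Qed.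
Lemma submoduleZ a x : N x -> N (a *: x).
Proof. by move=> Nx; rewrite -[_ *: _]addr0; apply: subN.2 => //; apply: subN.1. Qed.
Lemma submoduleN x : N x -> N (- x).
Proof. by move=> Nx; rewrite -scaleN1r; apply: submoduleZ. Qed.
Lemma submoduleB x y : N x -> N y -> N (x - y).
Proof. by move=> Nx Ny; apply: submoduleD => //; apply: submoduleN. Qed.
End Submodule.

Lemma submodule_eq0 (M : lmodType A) : submodule (fun x : M => x = 0).
Proof. by split=> // a x y -> ->; rewrite scaler0 addr0. Qed.

Lemma submodule_span (s : seq A) : submodule (ideal_span s : A^o -> Prop).
Proof.
split; first by exists (fun=> 0); rewrite big1 // => i _; rewrite mul0r.
move=> a x y [c ->] [d ->]; exists (fun i => a * c i + d i).
rewrite /GRing.scale /= mulr_sumr -big_split /=.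
by apply: eq_bigr => i _; rewrite mulrDl mulrA.
Qed.

Lemma mem_span (s : seq A) x : x \in s -> ideal_span s x.
Proof.
move=> xs; have lt : (index x s < size s)%N by rewrite index_mem.
exists (fun i => (i == Ordinal lt)%:R).
rewrite (bigD1 (Ordinal lt)) //= eqxx mul1r nth_index // big1 ?addr0 //.
by move=> i /negPf ->; rewrite mul0r.
Qed.

Lemma span_min (s : seq A) (N : A^o -> Prop) :
  submodule N -> (forall x, x \in s -> N x) -> forall x, ideal_span s x -> N x.
Proof.
move=> subN sN x [c ->]; apply: big_ind => [||i _].
- exact: subN.1.
- by move=> *; apply: (submoduleD subN).
- by apply: (submoduleZ subN); apply/sN/mem_nth.
Qed.

Lemma span_sub (s t : seq A) x :
  {subset s <= t} -> ideal_span s x -> ideal_span t x.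
Proof.
by move=> st; apply: span_min; [exact: submodule_span|move=> y /st /mem_span].
Qed.

Lemma span_rcons (s : seq A) a x :
  ideal_span (rcons s a) x ->
  exists b, ideal_span s (x - a * b).
Proof.
apply: (@span_min _ (fun x => exists b, ideal_span s (x - a * b))).
  split; first by exists 0; rewrite mulr0 subr0; exact: (submodule_span s).1.
  move=> c u v [b hb] [b' hb']; exists (c * b + b').
  rewrite (_ : _ - _ = c *: (u - a * b : A^o) + (v - a * b')); last first.
    by rewrite /GRing.scale /=; ring.
  exact: (submodule_span s).2.
move=> y; rewrite mem_rcons inE => /orP[/eqP ->|ys].
  by exists 1; rewrite mulr1 subrr; exact: (submodule_span s).1.
by exists 0; rewrite mulr0 subr0; apply: mem_span.
Qed.

Lemma exp_addr_span (s : seq A) m n a b :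
  ideal_span s (a ^+ m) -> ideal_span s (b ^+ n) ->
  ideal_span s ((a + b) ^+ (m + n)).
Proof.
move=> ha hb; rewrite exprDn; have sub := submodule_span s.
apply: big_ind => [||i _]; first exact: sub.1.
  by move=> *; apply: (submoduleD sub).
rewrite -mulr_natl; apply: (submoduleZ sub).
have [le|lt] := leqP n i.
  rewrite -(subnK le) exprD mulrA; exact: (submoduleZ sub).
have lm : (m <= m + n - i)%N by rewrite -addnBA ?leq_addr // ltnW.
rewrite -(subnK lm) exprD mulrAC; exact: (submoduleZ sub).
Qed.

Definition radical_span (s : seq A) (x : A) : Prop :=
  exists n, ideal_span s (x ^+ n).

Lemma submodule_radical (s : seq A) :
  submodule (radical_span s : A^o -> Prop).
Proof.
have sub := submodule_span s; split.
  by exists 1; rewrite expr1; exact: sub.1.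
move=> a x y [m hm] [n hn]; exists (m + n)%N; apply: exp_addr_span => //.
by rewrite exprMn; apply: (submoduleZ sub).
Qed.

(** * Ascending chains *)

Definition acc (M : lmodType A) : Prop :=
  forall N : nat -> M -> Prop, (forall n, submodule (N n)) ->
    (forall n x, N n x -> N n.+1 x) ->
    exists n, forall m x, (n <= m)%N -> N m x -> N n x.

Lemma chain_le (M : Type) (N : nat -> M -> Prop) :
  (forall n x, N n x -> N n.+1 x) ->
  forall m n x, (m <= n)%N -> N m x -> N n x.
Proof.
move=> incN m n x /subnK <-; elim: (n - m)%N => //= k IH Nm.
by apply: incN; apply: IH.
Qed.

Lemma noetherian_acc : noetherian A -> acc A^o.
Proof.
move=> noeth N subN incN; have leN := chain_le incN.
have [[n N1]|no1] := pselect (exists n, N n 1).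
  exists n => m x _ _; rewrite -[x]mulr1; exact: (submoduleZ (subN n)).
pose I : {pred A} := fun x => `[< exists n, N n x >].
have idI : idealr_closed I.
  split.
  - by apply/asboolP; exists 0%N; exact: (subN _).1.
  - by apply/asboolP.
  - move=> a x y /asboolP[m Nx] /asboolP[n Ny]; apply/asboolP.
    exists (m + n)%N; apply: (subN _).2.
      by apply: leN Nx; rewrite leq_addr.
    by apply: leN Ny; rewrite leq_addl.
have [s defI] := noeth _ idI.
have [n hn] : exists n, forall x, x \in s -> N n x.
  have : forall x, x \in s -> exists n, N n x.
    by move=> x xs; apply/asboolP; apply: (defI x).2 (mem_span xs).
  elim: s {defI} => [|y s IH] hs; first by exists 0%N.
  have [n hn] := IH (fun x xs => hs x (mem_behead (s := y :: s) xs)).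
  have [m hm] := hs y (mem_head _ _).
  exists (m + n)%N => x; rewrite inE => /orP[/eqP ->|xs].
    by apply: leN hm; rewrite leq_addr.
  by apply: leN (hn x xs); rewrite leq_addl.
exists n => m x _ Nx; apply: (span_min (subN n) hn).
by apply/defI/asboolP; exists m.
Qed.

Lemma pairZ (M N : lmodType A) a (x : M) (y : N) : a *: (x, y) = (a *: x, a *: y).
Proof. by []. Qed.
Lemma pairD (M N : lmodType A) (x x' : M) (y y' : N) :
  (x, y) + (x', y') = (x + x', y + y').
Proof. by []. Qed.
Lemma pairN (M N : lmodType A) (x : M) (y : N) : - (x, y) = (- x, - y).
Proof. by []. Qed.

Lemma acc_prod (M1 M2 : lmodType A) : acc M1 -> acc M2 -> acc (M1 * M2)%type.
Proof.
move=> acc1 acc2 N subN incN; have leN := chain_le incN.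
have [||n1 h1] := acc1 (fun n x => exists y, N n (x, y)).
- move=> n; split; first by exists 0; exact: (subN n).1.
  move=> a x x' [y Ny] [y' Ny']; exists (a *: y + y').
  exact: (subN n).2 a (x, y) (x', y') Ny Ny'.
- by move=> n x [y /incN Ny]; exists y.
have [||n2 h2] := acc2 (fun n y => N n (0, y)).
- move=> n; split; first exact: (subN n).1.
  move=> a y y' Ny Ny'; have := (subN n).2 a _ _ Ny Ny'.
  by rewrite pairZ pairD scaler0 addr0.
- by move=> n y; apply: incN.
exists (n1 + n2)%N => m [x y] le Nxy.
have le1 : (n1 <= m)%N by apply: leq_trans le; rewrite leq_addr.
have le2 : (n2 <= m)%N by apply: leq_trans le; rewrite leq_addl.
have [y' Nxy'] := h1 m x le1 (ex_intro _ y Nxy).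
have Nd : N n2 (0, y - y').
  apply: h2 le2 _; have := submoduleB (subN m) Nxy (leN _ _ _ le1 Nxy').
  by rewrite pairN pairD subrr.
have := submoduleD (subN (n1 + n2)%N) (leN _ _ _ (leq_addl _ _) Nd)
                   (leN _ _ _ (leq_addr _ _) Nxy').
by rewrite pairD add0r subrK.
Qed.

Definition jacobson (y : A) : Prop := forall r, exists w, (1 - r * y) * w = 1.

(* For [x 0 := z] and [x n = b n + y x (n+1)] with [b n] in [B], the submodules
   [B + A x n] form an ascending chain; where it stabilizes, [1 - r y] kills
   [x (n+1)] modulo [B]. *)
Lemma nakayama (M : lmodType A) (Z B : M -> Prop) y :
  acc M -> jacobson y -> submodule B ->
  (forall z, Z z -> exists2 z', Z z' & B (z - y *: z')) ->
  forall z, Z z -> B z.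
Proof.
move=> accM jy subB step z Zz.
pose next (u : M) := if pselect (Z u) is left Zu then sval (cid2 (step u Zu)) else 0.
have nextP u : Z u -> Z (next u) /\ B (u - y *: next u).
  by move=> Zu; rewrite /next; case: pselect => // Zu'; case: cid2.
pose x n := iter n next z.
have Zx n : Z (x n) by elim: n => //= n /nextP[].
have Bx n : B (x n - y *: x n.+1) by exact: (nextP _ (Zx n)).2.
pose N n u := exists r, B (u - r *: x n).
have [||n hn] := accM N.
- move=> n; split; first by exists 0; rewrite scale0r subr0; exact: subB.1.
  move=> a u v [r hr] [s hs]; exists (a * r + s).
  have := subB.2 a _ _ hr hs; congr B.
  by rewrite scalerDl scalerBr scalerA opprD addrACA.
- move=> n u [r hr]; exists (r * y).
  have := submoduleD subB hr (submoduleZ subB r (Bx n)); congr B.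
  by rewrite scalerBr scalerA addrA subrK.
have Bn : B (x n.+1).
  have [|r hr] := hn n.+1 (x n.+1) (leqnSn n).
    by exists 1; rewrite scale1r subrr; exact: subB.1.
  have := submoduleD subB hr (submoduleZ subB r (Bx n)).
  rewrite scalerBr scalerA addrA subrK => h.
  have [w hw] := jy r; rewrite -[x n.+1]scale1r -hw mulrC -scalerA.
  by apply: (submoduleZ subB); rewrite scalerBl scale1r.
suff H m : B (x m) -> B (x 0%N) by exact: H Bn.
elim: m => // m IH Bm; apply: IH.
by rewrite -[x m](subrK (y *: x m.+1)); apply: (submoduleD subB) => //; apply: submoduleZ.
Qed.

(** * Koszul cochains *)

(* The cochains on [f :: fs] are the mapping cone of multiplication by [f] on
   the cochains on [fs]. *)
Fixpoint cochain (n : nat) : lmodType A :=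
  if n is n'.+1 then (cochain n' * cochain n')%type else A^o.

Fixpoint diff (fs : seq A) : cochain (size fs) -> cochain (size fs) :=
  match fs with
  | [::] => fun=> 0
  | f :: fs' => fun z => (diff z.1, f *: z.1 - diff z.2)
  end.

(* The cochains of degree [i - 1]; in particular index [0] only contains 0. *)
Fixpoint index_deg (n i : nat) : cochain n -> Prop :=
  match n with
  | 0 => fun z => i = 1%N \/ z = 0
  | n'.+1 => fun z => index_deg i z.1 /\ index_deg i.-1 z.2
  end.

Fixpoint entries_in (H : A -> Prop) n : cochain n -> Prop :=
  match n with
  | 0 => H
  | n'.+1 => fun z => entries_in H z.1 /\ entries_in H z.2
  end.

Lemma diff_linear fs a (x y : cochain (size fs)) :
  diff (a *: x + y) = a *: diff x + diff y.
Proof.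
elim: fs x y => [|f fs IH] /= x y; first by rewrite scaler0 addr0.
case: x y => [x1 x2] [y1 y2] /=; rewrite !IH pairZ pairD; congr (_, _).
by rewrite scalerDr scalerBr !scalerA [f * a]mulrC opprD addrACA.
Qed.

Lemma diff0 fs : diff (0 : cochain (size fs)) = 0.
Proof.
have := diff_linear (-1) 0 (0 : cochain (size fs)).
by rewrite scaler0 addr0 scaleN1r addNr.
Qed.
Lemma diffD fs (x y : cochain (size fs)) : diff (x + y) = diff x + diff y.
Proof. by rewrite -[x]scale1r diff_linear !scale1r. Qed.
Lemma diffZ fs a (x : cochain (size fs)) : diff (a *: x) = a *: diff x.
Proof. by rewrite -[_ *: _]addr0 diff_linear diff0 !addr0. Qed.
Lemma diffN fs (x : cochain (size fs)) : diff (- x) = - diff x.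
Proof. by rewrite -scaleN1r diffZ scaleN1r. Qed.
Lemma diffB fs (x y : cochain (size fs)) : diff (x - y) = diff x - diff y.
Proof. by rewrite diffD diffN. Qed.

Lemma diff_diff fs (z : cochain (size fs)) : diff (diff z) = 0.
Proof.
elim: fs z => //= f fs IH [x y] /=.
by rewrite diffB diffZ !IH subr0 subrr.
Qed.

Lemma index_deg_submodule n i : submodule (@index_deg n i).
Proof.
elim: n i => [|n IH] i.
  split; first by right.
  move=> a x y [i1|->]; first by left.
  by move=> [i1|->]; [left|right; rewrite scaler0 addr0].
split; first by split; exact: (IH _).1.
by move=> a [x1 x2] [y1 y2] [h1 h2] [k1 k2]; split; apply: (IH _).2.
Qed.

Lemma entries_submodule (H : A -> Prop) n :
  submodule (H : A^o -> Prop) -> submodule (@entries_in H n).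
Proof.
move=> subH; elim: n => [|n IH] //.
split; first by split; exact: IH.1.
by move=> a [x1 x2] [y1 y2] [h1 h2] [k1 k2]; split; apply: IH.2.
Qed.

Lemma index_deg_diff fs i (z : cochain (size fs)) :
  index_deg i.-1 z -> index_deg i (diff z).
Proof.
elim: fs i z => [|f fs IH] i /=; first by right.
move=> [x y] /= [hx hy]; split; first exact: IH.
apply: submoduleB; first exact: index_deg_submodule.
  by apply: submoduleZ => //; exact: index_deg_submodule.
exact: IH.
Qed.

Lemma entries_diff (H : A -> Prop) fs (z : cochain (size fs)) :
  submodule (H : A^o -> Prop) -> entries_in H z -> entries_in H (diff z).
Proof.
move=> subH; elim: fs z => [|f fs IH] /=; first by move=> *; exact: subH.1.
move=> [x y] /= [hx hy]; split; first exact: IH.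
have subT := entries_submodule (size fs) subH.
by apply: (submoduleB subT); [apply: (submoduleZ subT)|apply: IH].
Qed.

Lemma index_deg0 n (z : cochain n) : index_deg 0 z -> z = 0.
Proof.
elim: n z => [|n IH] /=; first by move=> z [].
by move=> [x y] /= [/IH -> /IH ->].
Qed.

Lemma entries_eq0 n (z : cochain n) : entries_in (fun x => x = 0) z <-> z = 0.
Proof.
split; last by move=> ->; apply: (entries_submodule n (submodule_eq0 A^o)).1.
by elim: n z => [|n IH] //= [x y] /= [/IH -> /IH ->].
Qed.

Lemma entries_split (H H' : A -> Prop) a n i (z : cochain n) :
  submodule (H : A^o -> Prop) ->
  (forall x, H' x -> exists b, H (x - a * b)) ->
  index_deg i z -> entries_in H' z ->
  exists2 w, index_deg i w & entries_in H (z - a *: w).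
Proof.
move=> subH split; elim: n i z => [|n IH] i /=.
  move=> z [->|->] hz; first by have [b hb] := split z hz; exists b => //; left.
  by exists 0; [right|rewrite scaler0 subr0; exact: subH.1].
move=> [x y] /= [ix iy] [hx hy].
have [u iu hu] := IH _ _ ix hx; have [v iv hv] := IH _ _ iy hy.
by exists (u, v).
Qed.

Lemma entries_cancel (H : A -> Prop) a n (z : cochain n) :
  (forall x, H (a * x) -> H x) -> entries_in H (a *: z) -> entries_in H z.
Proof.
move=> reg; elim: n z => [|n IH] /=; first exact: reg.
by move=> [x y] /= [/IH hx /IH hy].
Qed.

Lemma entries_mul (H' : A -> Prop) a n (z : cochain n) :
  (forall x, H' (a * x)) -> entries_in H' (a *: z).
Proof. by move=> ha; elim: n z => [|n IH] z /=; [exact: ha|split; exact: IH]. Qed.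

Lemma entries_sub (H H' : A -> Prop) n (z : cochain n) :
  (forall x, H x -> H' x) -> entries_in H z -> entries_in H' z.
Proof. by move=> ha; elim: n z => [|n IH] z /=; [exact: ha|case=> /IH ? /IH ?]. Qed.

(* Contraction against the basis vector of [f]: [f = d h + h d]. *)
Lemma homotopy fs f : f \in fs ->
  exists h : cochain (size fs) -> cochain (size fs),
    [/\ forall z, f *: z = diff (h z) + h (diff z),
        forall x y, h (x - y) = h x - h y,
        forall a x, h (a *: x) = a *: h x,
        forall i z, index_deg i z -> index_deg i.-1 (h z)
      & forall (H : A -> Prop) z, submodule (H : A^o -> Prop) ->
          entries_in H z -> entries_in H (h z)].
Proof.
elim: fs => //= g fs IH; rewrite inE; have [-> _|_ /= /IH[h [hd hB hZ hi hH]]] := eqVneq f g.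
  exists (fun z => (z.2, 0)); split=> //=.
  - by move=> [x y] /=; rewrite pairZ pairD diff0 subr0 addr0 addrC subrK.
  - by move=> [x y] [x' y'] /=; rewrite pairN pairD subrr.
  - by move=> a [x y] /=; rewrite pairZ scaler0.
  - by move=> i [x y] /= [_ iy]; split=> //; exact: (index_deg_submodule _ _).1.
  - by move=> H [x y] subH /= [_ hy]; split=> //; exact: (entries_submodule _ subH).1.
exists (fun z => (h z.1, - h z.2)); split=> //=.
- move=> [x y] /=; rewrite pairZ pairD hB hZ diffN opprB opprK !hd.
  by rewrite [g *: _ + _]addrC addrACA subrr addr0.
- by move=> [x y] [x' y'] /=; rewrite !hB pairN pairD opprD.
- by move=> a [x y] /=; rewrite !hZ pairZ scalerN.
- move=> i [x y] /= [/hi ix /hi iy]; split=> //.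
  by apply: submoduleN => //; exact: index_deg_submodule.
- move=> H [x y] subH /= [hx hy]; split; first exact: hH.
  by apply: submoduleN; [exact: entries_submodule|exact: hH].
Qed.

(* Vanishing of the Koszul cohomology of [A/H] in all degrees below [g]. *)
Definition vanishing (fs : seq A) (H : A -> Prop) (g : nat) : Prop :=
  forall i (z : cochain (size fs)), (i <= g)%N -> index_deg i z ->
    entries_in H (diff z) ->
    exists2 w, index_deg i.-1 w & entries_in H (z - diff w).

Lemma span_kills fs (H : A -> Prop) b i (z : cochain (size fs)) :
  submodule (H : A^o -> Prop) -> ideal_span fs b ->
  index_deg i z -> entries_in H (diff z) ->
  exists2 w, index_deg i.-1 w & entries_in H (b *: z - diff w).
Proof.
move=> subH fsb iz dz; have subT := entries_submodule (size fs) subH.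
have subI := index_deg_submodule (size fs) i.-1.
pose N b := exists2 w, index_deg i.-1 w & entries_in H (b *: z - diff w).
apply: (@span_min fs N) fsb.
  split; first by exists 0; [exact: subI.1|rewrite scale0r diff0 subr0; exact: subT.1].
  move=> a x y [u iu hu] [v iv hv]; exists (a *: u + v); first exact: subI.2.
  have := subT.2 a _ _ hu hv; congr entries_in.
  by rewrite diff_linear scalerDl scalerBr scalerA opprD addrACA.
move=> f /homotopy[h [hd hB hZ hi hH]]; exists (h z); first exact: hi.
by rewrite hd addrC addKr; apply: hH.
Qed.

Lemma vanishing_regular fs (H H' : A -> Prop) a g :
  submodule (H : A^o -> Prop) ->
  (forall x, H x -> H' x) -> (forall x, H' (a * x)) ->
  submodule (H' : A^o -> Prop) ->
  (forall x, H' x -> exists b, H (x - a * b)) ->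
  (forall x, H (a * x) -> H x) -> radical_span fs a ->
  vanishing fs H' g -> vanishing fs H g.+1.
Proof.
move=> subH HH' aH' subH' split reg [n an] van i z ig iz dz.
have subT := entries_submodule (size fs) subH.
have subT' := entries_submodule (size fs) subH'.
have ig' : (i.-1 <= g)%N by case: i ig {iz}.
have := span_kills subH an iz dz.
elim: n {an} => [[w iw]|n IH [w iw hw]]; first by rewrite expr0 scale1r; exists w.
have dw : entries_in H' (diff w).
  have hw' := entries_sub HH' hw; rewrite -[diff w](subKr (a ^+ n.+1 *: z)).
  by apply: (submoduleB subT') => //; rewrite exprS -scalerA; apply: entries_mul.
have [w' iw' hw'] := van _ _ ig' iw dw.
have subI := index_deg_submodule (size fs) i.-1.
have iww' := submoduleB subI iw (index_deg_diff iw').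
have [u iu hu] := entries_split subH split iww' hw'.
apply: IH; exists u => //; apply: (entries_cancel reg).
have := submoduleD subT hw (entries_diff subH hu); congr entries_in.
rewrite !diffB diff_diff subr0 diffZ scalerBr scalerA -exprS addrA subrK //.
Qed.

Lemma vanishing_regular_seq fs (s : seq A) :
  (forall a, a \in s -> radical_span fs a) -> regular_seq s ->
  vanishing fs (fun x => x = 0) (size s).
Proof.
move=> rad [reg _].
suff H k : (k <= size s)%N ->
    vanishing fs (ideal_span (take (size s - k) s)) k.
  have := H _ (leqnn _); rewrite subnn take0 => van i z ig iz dz.
  have [|w iw hw] := van i z ig iz.
    by apply: entries_sub dz => x ->; exact: (submodule_span _).1.
  by exists w => //; apply: entries_sub hw => x [c ->]; rewrite big_ord0.
elim: k => [_ i z|k IH lt].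
  rewrite leqn0 => /eqP -> iz _; exists 0; first exact: (index_deg_submodule _ _).1.
  rewrite (index_deg0 iz) diff0 subr0.
  by apply: (entries_submodule _ (submodule_span _)).1.
set j := (size s - k.+1)%N; have js : (j < size s)%N by rewrite ltn_subrL; case: (size s) lt.
have ej : (size s - k = j.+1)%N by rewrite /j -subSn.
have := IH (ltnW lt); rewrite ej (take_nth 0) // => van.
apply: vanishing_regular van.
- exact: submodule_span.
- by move=> x; apply: span_sub => y; rewrite mem_rcons inE orbC => ->.
- have sj : ideal_span (rcons (take j s) s`_j) s`_j.
    by apply: mem_span; rewrite mem_rcons mem_head.
  by move=> x; rewrite mulrC; apply: (submoduleZ (submodule_span _) x sj).
- exact: submodule_span.
- by move=> x; apply: span_rcons.
- by move=> x; apply: reg.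
- by apply: rad; rewrite mem_nth.
Qed.

Lemma acc_cochain n : noetherian A -> acc (cochain n).
Proof.
move=> noeth; elim: n => [|n IH] /=; first exact: noetherian_acc.
exact: acc_prod.
Qed.

Lemma vanishing_behead y fs g :
  noetherian A -> jacobson y ->
  vanishing (y :: fs) (fun x => x = 0) g.+1 ->
  vanishing fs (fun x => x = 0) g.
Proof.
move=> noeth jy van i z ig iz /entries_eq0 dz.
pose Z u := index_deg i u /\ diff u = 0 :> cochain (size fs).
pose B u := exists2 w, index_deg i.-1 w & u = diff w :> cochain (size fs).
suff [w iw ->] : B z by exists w => //; apply/entries_eq0; rewrite subrr.
have subB : submodule B.
  split; first by exists 0; [exact: (index_deg_submodule _ _).1|rewrite diff0].
  move=> a u v [w iw ->] [w' iw' ->]; exists (a *: w + w'); last by rewrite diff_linear.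
  exact: (index_deg_submodule _ _).2.
apply: (nakayama (Z := Z) (acc_cochain noeth) jy subB); last by [].
move=> u [iu du].
have [||[p q] [ip iq] /entries_eq0] := van i.+1 ((0, u) : cochain (size fs).+1) ig.
- by split=> //; exact: (index_deg_submodule _ _).1.
- by apply/entries_eq0; rewrite /= diff0 du scaler0 subrr.
rewrite /= pairN pairD sub0r => -[/eqP]; rewrite oppr_eq0 => /eqP dp.
rewrite opprB => /eqP; rewrite addrCA addr_eq0 => /eqP eu.
exists p; first by split.
by exists (- q); [apply: submoduleN iq; exact: index_deg_submodule|rewrite diffN eu opprK].
Qed.

Lemma vanishing_cat ys fs g :
  noetherian A -> (forall y, y \in ys -> jacobson y) ->
  vanishing (ys ++ fs) (fun x => x = 0) (size ys + g) ->
  vanishing fs (fun x => x = 0) g.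
Proof.
move=> noeth; elim: ys => //= y ys IH jac /vanishing_behead van.
apply: IH => [x xs|]; first by apply: jac; rewrite inE xs orbT.
by apply: van => //; apply: jac; rewrite mem_head.
Qed.

Fixpoint constant_cochain n : A -> cochain n :=
  if n is n'.+1 then fun b => (constant_cochain n' b, 0) else id.

Fixpoint linear_cochain (T : Type) (F B : T -> A) (l : seq T) :
    cochain (size (map F l)) :=
  if l is t :: l' then (linear_cochain F B l', constant_cochain _ (B t)) else 0.

Lemma constant_cochainZ n b c :
  constant_cochain n (b * c) = b *: constant_cochain n c.
Proof. by elim: n => //= n ->; rewrite pairZ scaler0. Qed.

Lemma constant_cochain_inj n : injective (constant_cochain n).
Proof. by elim: n => [|n IH] //= b c [/IH]. Qed.

Lemma index_deg1 n (z : cochain n) :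
  index_deg 1 z -> exists b, z = constant_cochain n b.
Proof.
elim: n z => [|n IH] /=; first by move=> z _; exists z.
by move=> [x y] /= [/IH[b ->] /index_deg0 ->]; exists b.
Qed.

Lemma index_deg_constant n b : index_deg 1 (constant_cochain n b).
Proof.
by elim: n => [|n IH] /=; [left|split=> //; exact: (index_deg_submodule _ _).1].
Qed.

Lemma index_deg_linear (T : Type) (F B : T -> A) l :
  index_deg 2 (linear_cochain F B l).
Proof.
by elim: l => [|t l IH] /=; [right|split=> //; exact: index_deg_constant].
Qed.

Lemma diff_constant (T : Type) (F : T -> A) l b :
  diff (constant_cochain (size (map F l)) b)
    = linear_cochain F (fun t => b * F t) l.
Proof.
elim: l => //= t l IH; rewrite IH diff0 subr0.
by rewrite mulrC constant_cochainZ.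
Qed.

Lemma linear_cochainZ (T : eqType) (F B B' : T -> A) l a :
  (forall t, t \in l -> a * B t = B' t) ->
  a *: linear_cochain F B l = linear_cochain F B' l.
Proof.
elim: l => [|t l IH] /= hB; first by rewrite scaler0.
rewrite pairZ IH => [|u ul]; last by apply: hB; rewrite inE ul orbT.
by rewrite -constant_cochainZ hB ?mem_head.
Qed.

Lemma diff_linear_cochain (T : eqType) (F B : T -> A) l :
  (forall t u, t \in l -> u \in l -> F t * B u = F u * B t) ->
  diff (linear_cochain F B l) = 0.
Proof.
elim: l => [|t l IH] //= hB; rewrite IH => [|u v ul vl]; last first.
  by apply: hB; rewrite inE (ul, vl) orbT.
rewrite diff_constant (@linear_cochainZ _ F B (fun u => B t * F u)) ?subrr //.
by move=> u ul; rewrite hB ?mem_head ?inE ?ul ?orbT // mulrC.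
Qed.

Lemma linear_cochain_inj (T : eqType) (F B B' : T -> A) l :
  linear_cochain F B l = linear_cochain F B' l ->
  forall t, t \in l -> B t = B' t.
Proof.
elim: l => //= u l IH [/IH h /constant_cochain_inj hu] t.
by rewrite inE => /orP[/eqP ->|/h].
Qed.

Lemma vanishing_multiplier (T : eqType) (F B : T -> A) l :
  vanishing (map F l) (fun x => x = 0) 2 ->
  (forall t u, t \in l -> u \in l -> F t * B u = F u * B t) ->
  exists e, forall t, t \in l -> B t = e * F t.
Proof.
move=> van comm.
have [||w /index_deg1[e ->] /entries_eq0/eqP] := van 2 (linear_cochain F B l) isT.
- exact: index_deg_linear.
- by apply/entries_eq0; apply: diff_linear_cochain.
rewrite subr_eq0 diff_constant => /eqP/linear_cochain_inj eB.
by exists e.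
Qed.

Lemma regular_seq_multiplier (T : eqType) (F B : T -> A) l ys s :
  noetherian A -> (forall y, y \in ys -> jacobson y) ->
  regular_seq s -> (size ys + 2 <= size s)%N ->
  (forall a, a \in s -> radical_span (ys ++ map F l) a) ->
  (forall t u, t \in l -> u \in l -> F t * B u = F u * B t) ->
  exists e, forall t, t \in l -> B t = e * F t.
Proof.
move=> noeth jac reg le rad; apply: vanishing_multiplier.
apply: vanishing_cat noeth jac _ => i z ig.
by apply: vanishing_regular_seq rad reg _ _ _; apply: leq_trans le.
Qed.

End CommutativeAlgebra.


Section ElementarySymmetric.
Import GRing.Theory.
Local Open Scope ring_scope.

(* Expanding [0 = \prod_w (x v - x w)] expresses [x v ^+ #|T|] through the
   elementary symmetric polynomials of positive degree. *)
Lemma exp_card_elementary (A : comNzRingType) (T : finType) (x : T -> A)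
    (N : A^o -> Prop) :
  submodule N ->
  (forall j, (0 < j)%N -> N (\sum_(S : {set T} | #|S| == j) \prod_(w in S) x w)) ->
  forall v, N (x v ^+ #|T|).
Proof.
move=> subN Ne v.
have: \prod_(w : T) (- x w + x v) = 0.
  by rewrite (bigD1 v) //= addNr mul0r.
rewrite bigA_distr (partition_big (fun S : {set T} => inord #|S| : 'I_#|T|.+1) xpredT) //=.
rewrite big_ord_recl /= => /eqP; rewrite addr_eq0 => /eqP.
rewrite (big_pred1 set0) => [|S]; last first.
  rewrite -(inj_eq val_inj) /= inordK ?ltnS ?max_card // cards_eq0 //.
have -> : \prod_i (if i \in set0 then - x i else x v) = x v ^+ #|T|.
  by rewrite -[RHS]prodr_const; apply: eq_big => // i; rewrite inE.
move=> ->; apply: (submoduleN subN); apply: big_ind => [||j _].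
- exact: subN.1.
- by move=> *; apply: (submoduleD subN).
have := submoduleZ subN ((-1) ^+ j.+1 * x v ^+ (#|T| - j.+1)) (Ne j.+1 isT).
congr N; rewrite /GRing.scale /= mulr_sumr; apply: eq_big => S.
  by rewrite -(inj_eq val_inj) /= inordK ?ltnS ?max_card.
move=> /eqP cS; rewrite [RHS](bigID (mem S)) /= mulrAC; congr (_ * _).
  transitivity (\prod_(i in S) (- x i)); last by apply: eq_bigr => i ->.
  by rewrite prodrN cS.
transitivity (\prod_(i | i \notin S) x v); last by apply: eq_bigr => i /negPf ->.
by rewrite prodr_const -cS -(cardC (mem S)) addKn.
Qed.

End ElementarySymmetric.

Section Restriction.
Import GRing.Theory.
Local Open Scope ring_scope.
Local Open Scope quotient_scope.
Variables (K : fieldType) (G : sgraph).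
Local Notation S := {mpoly K[#|G|]}.
Local Notation R := (edge_ring K G).

Lemma mpoly_ring_ind n (P : {mpoly K[n]} -> Prop) :
  (forall c, P c%:MP) -> (forall i, P 'X_i) ->
  (forall p q, P p -> P q -> P (p + q)) ->
  (forall p q, P p -> P q -> P (p * q)) -> forall p, P p.
Proof.
move=> PC PX PD PM; elim/mpolyind => [|c m p _ _ Pp].
  by rewrite -mpolyC0.
apply: PD => //; rewrite -mul_mpolyC; apply: (PM) => //; rewrite mpolyXE_id.
apply: (big_ind P) => [|p' q'|i _]; [by rewrite -mpolyC1|exact: PM|].
by elim: (m i) => [|k IH]; rewrite ?expr0 -?mpolyC1 // exprS; apply: PM.
Qed.

Lemma vertex_var_neq0 v : vertex_var K v != 0 :> S.
Proof. by rewrite /vertex_var -msize_poly_eq0 msizeX mdeg1. Qed.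

Definition restr_poly (F : {set G}) (p : S) : S :=
  p \mPo [tuple (if enum_val i \in F then 'X_i else 0) | i < #|G|].

Lemma restr_polyX F i :
  restr_poly F 'X_i = if enum_val i \in F then 'X_i else 0.
Proof. by rewrite /restr_poly comp_mpolyXU -tnth_nth tnth_mktuple. Qed.

Lemma restr_polyC F c : restr_poly F c%:MP = c%:MP.
Proof. exact: comp_mpolyC. Qed.
Lemma restr_polyD F p q : restr_poly F (p + q) = restr_poly F p + restr_poly F q.
Proof. exact: comp_mpolyD. Qed.
Lemma restr_polyN F p : restr_poly F (- p) = - restr_poly F p.
Proof. exact: comp_mpolyN. Qed.
Lemma restr_polyM F p q : restr_poly F (p * q) = restr_poly F p * restr_poly F q.
Proof. exact: rmorphM. Qed.

Lemma restr_poly_sub (E F : {set G}) p :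
  E \subset F -> restr_poly E (restr_poly F p) = restr_poly E p.
Proof.
move=> EF; elim/mpoly_ring_ind: p => [c|i|p q IHp IHq|p q IHp IHq].
- by rewrite !restr_polyC.
- rewrite !restr_polyX; case: ifP => iF; first by rewrite restr_polyX.
  rewrite -[0]mpolyC0 restr_polyC; case: ifP => // iE.
  by rewrite (subsetP EF _ iE) in iF.
- by rewrite !restr_polyD IHp IHq.
- by rewrite !restr_polyM IHp IHq.
Qed.

Lemma restr_poly_set0 p : exists c, restr_poly set0 p = c%:MP.
Proof.
elim/mpoly_ring_ind: p => [c|i|p q [c hc] [d hd]|p q [c hc] [d hd]].
- by exists c; rewrite restr_polyC.
- by exists 0; rewrite restr_polyX inE mpolyC0.
- by exists (c + d); rewrite restr_polyD hc hd mpolyCD.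
- by exists (c * d); rewrite restr_polyM hc hd mpolyCM.
Qed.

Lemma restr_poly_edge_ideal F p :
  independent F -> p \in @edge_ideal K G -> restr_poly F p = 0.
Proof.
move=> /forall_inP indF /asboolP[c ->]; rewrite /restr_poly rmorph_sum big1 //= => i _.
have /mapP[e] : (edge_monomials K G)`_i \in edge_monomials K G by rewrite mem_nth.
rewrite mem_enum inE => adj_e ->; rewrite -/(restr_poly F _) !restr_polyM.
rewrite !restr_polyX !enum_rankK.
case: ifP => e1; case: ifP => e2; rewrite ?(mulr0, mul0r) //.
by have := forall_inP (indF _ e1) _ e2; rewrite adj_e.
Qed.

Definition restr (F : {set G}) (a : R) : S := restr_poly F (repr a).

Definition edge_pi (p : S) : R := \pi_({ideal_quot (@edge_ideal K G)}) p.

Lemma edge_piD p q : edge_pi (p + q) = edge_pi p + edge_pi q.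
Proof. exact: rmorphD. Qed.
Lemma edge_piB p q : edge_pi (p - q) = edge_pi p - edge_pi q.
Proof. exact: rmorphB. Qed.
Lemma edge_piM p q : edge_pi (p * q) = edge_pi p * edge_pi q.
Proof. exact: rmorphM. Qed.
Lemma edge_pi0 : edge_pi 0 = 0. Proof. exact: rmorph0. Qed.
Lemma edge_pi1 : edge_pi 1 = 1. Proof. exact: rmorph1. Qed.

Lemma edge_pi_surj a : exists p, a = edge_pi p.
Proof. by exists (repr a); rewrite /edge_pi reprK. Qed.

Lemma edge_pi_eq0 p : p \in @edge_ideal K G -> edge_pi p = 0.
Proof.
move=> pI; rewrite -edge_pi0; apply/eqP.
by rewrite /edge_pi -Quotient.idealrBE subr0.
Qed.

Section IndependentRestriction.
Variable F : {set G}.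
Hypothesis indF : independent F.

Lemma restr_pi p : restr F (edge_pi p) = restr_poly F p.
Proof.
apply/eqP; rewrite -subr_eq0 -restr_polyN -restr_polyD; apply/eqP.
apply: restr_poly_edge_ideal => //.
by rewrite Quotient.idealrBE reprK.
Qed.

Lemma restrD a b : restr F (a + b) = restr F a + restr F b.
Proof.
have [[p ->] [q ->]] := (edge_pi_surj a, edge_pi_surj b).
by rewrite -edge_piD !restr_pi restr_polyD.
Qed.

Lemma restrM a b : restr F (a * b) = restr F a * restr F b.
Proof.
have [[p ->] [q ->]] := (edge_pi_surj a, edge_pi_surj b).
by rewrite -edge_piM !restr_pi restr_polyM.
Qed.

Lemma restr0 : restr F 0 = 0.
Proof. by rewrite -edge_pi0 restr_pi -mpolyC0 restr_polyC. Qed.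

Lemma restr1 : restr F 1 = 1.
Proof. by rewrite -edge_pi1 restr_pi -mpolyC1 restr_polyC. Qed.

Lemma restrB a b : restr F (a - b) = restr F a - restr F b.
Proof.
have [[p ->] [q ->]] := (edge_pi_surj a, edge_pi_surj b).
by rewrite -edge_piB !restr_pi restr_polyD restr_polyN.
Qed.

Lemma restr_sub (E : {set G}) a :
  independent E -> E \subset F -> restr F a = 0 -> restr E a = 0.
Proof.
move=> indE EF; have [p ->] := edge_pi_surj a; rewrite restr_pi => p0.
rewrite -[edge_pi p]reprK -/(edge_pi _).
rewrite /restr -(restr_poly_sub _ EF) -/(restr F _).
rewrite /edge_pi reprK -/(edge_pi p) restr_pi p0 -mpolyC0.
by rewrite restr_polyC.
Qed.

End IndependentRestriction.

Lemma independent0 : independent (set0 : {set G}).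
Proof. by apply/forall_inP => x; rewrite inE. Qed.

Definition evar (v : G) : R := edge_pi (vertex_var K v).
Definition emon (A : {set G}) : R := \prod_(v in A) evar v.

Lemma restr_evar F v : independent F ->
  restr F (evar v) = if v \in F then vertex_var K v else 0.
Proof. by move=> indF; rewrite restr_pi // restr_polyX enum_rankK. Qed.

Lemma evar_edge v w : adj v w -> evar v * evar w = 0.
Proof.
move=> vw; rewrite /evar -edge_piM edge_pi_eq0 //.
apply/asboolP/mem_span/mapP; exists (v, w) => //.
by rewrite mem_enum.
Qed.

Lemma emon_dependent (A B : {set G}) :
  ~~ independent (A :|: B) -> emon A * emon B = 0.
Proof.
rewrite negb_forall_in => /exists_inP[v vAB]; rewrite negb_forall_in.
move=> /exists_inP[w wAB]; rewrite negbK => vw.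
have vw' : v != w by apply: contraTneq vw => ->; rewrite adj_irrefl.
have -> : emon A * emon B = emon (A :&: B) * emon (A :|: B).
  rewrite /emon (big_setID B) /= -mulrA; congr (_ * _).
  by rewrite [in RHS](big_setID B) /= setDUl setDv setU0 (setIidPr (subsetUr A B)) mulrC.
rewrite [emon (A :|: B)](bigD1 v) // (bigD1 w) /= ?wAB 1?eq_sym //.
by rewrite [evar v * _]mulrA evar_edge // mul0r mulr0.
Qed.


Lemma restr_emon F : independent F -> restr F (emon F) != 0.
Proof.
move=> indF; rewrite /emon.
apply: (big_ind (fun a => restr F a != 0)) => [|a b|v vF].
- by rewrite restr1 // oner_neq0.
- by move=> a0 b0; rewrite restrM // mulf_neq0.
by rewrite restr_evar // vF vertex_var_neq0.
Qed.

Definition irrelevant : {pred R} := fun a => restr set0 a == 0.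

Lemma irrelevantE a : (a \in irrelevant) = (restr set0 a == 0).
Proof. by []. Qed.

Lemma irrelevant_closed : idealr_closed irrelevant.
Proof.
have ind0 := independent0; split.
- by rewrite irrelevantE restr0.
- by rewrite irrelevantE restr1 // oner_eq0.
- move=> a x y; rewrite !irrelevantE => /eqP x0 /eqP y0.
  by rewrite restrD // restrM // x0 y0 mulr0 addr0.
Qed.

Lemma irrelevant_prime : prime_idealr_closed irrelevant.
Proof. by move=> a b; rewrite !irrelevantE restrM ?independent0 // mulf_eq0. Qed.

HB.instance Definition _ := isIdealr.Build R irrelevant irrelevant_closed.
HB.instance Definition _ := isPrimeIdealrClosed.Build R irrelevant irrelevant_prime.

Lemma evar_irrelevant v : evar v \in irrelevant.
Proof. by rewrite irrelevantE restr_evar ?independent0 // inE. Qed.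

Lemma irrelevant_maximal : maximal_ideal irrelevant.
Proof.
split=> [|J idJ subJ a aJ]; first exact: irrelevant_closed.
have [p ap] := edge_pi_surj a; have [c hc] := restr_poly_set0 p.
have ind0 := independent0; rewrite irrelevantE ap restr_pi // hc mpolyC_eq0.
apply: contraT => c0; case: idJ => J0 J1 JD; case/negP: J1.
have Jd : edge_pi (p - c%:MP) \in J.
  apply: subJ; rewrite irrelevantE restr_pi //.
  by rewrite restr_polyD restr_polyN restr_polyC hc subrr.
have := JD (- edge_pi (c^-1)%:MP) _ _ Jd (JD (edge_pi (c^-1)%:MP) _ _ aJ J0).
congr (_ \in J); rewrite addr0 ap mulNr -!edge_piM -edge_pi1 addrC -edge_piB.
by congr edge_pi; rewrite -mulrBr subKr -mpolyCM mulVf // mpolyC1.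
Qed.

Lemma irrelevant_sub (N : R^o -> Prop) :
  submodule N -> (forall v, N (evar v)) -> forall a, a \in irrelevant -> N a.
Proof.
move=> subN Nv a; have [p ->] := edge_pi_surj a.
rewrite irrelevantE restr_pi ?independent0 // => /eqP p0.
suff: N (edge_pi (p - restr_poly set0 p)) by rewrite p0 subr0.
elim/mpoly_ring_ind: p {p0} => [c|i|p q Np Nq|p q Np Nq].
- by rewrite restr_polyC subrr edge_pi0; exact: subN.1.
- rewrite restr_polyX inE subr0; have := Nv (enum_val i).
  by rewrite /evar /vertex_var enum_valK.
- rewrite restr_polyD opprD addrACA edge_piD; exact: (submoduleD subN Np Nq).
- have -> : p * q - restr_poly set0 (p * q) =
    p * (q - restr_poly set0 q) + restr_poly set0 q * (p - restr_poly set0 p).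
    by rewrite restr_polyM; ring.
  rewrite edge_piD !edge_piM; apply: (submoduleD subN).
    exact: (submoduleZ subN (edge_pi p) Nq).
  exact: (submoduleZ subN (edge_pi _) Np).
Qed.


(** * The localization at the irrelevant ideal *)

Local Notation A := {localization irrelevant}.

Definition loc (a : R) : A :=
  Localization.mkfrac a (Localization.one_notin irrelevant).

Lemma locD a b : loc (a + b) = loc a + loc b.
Proof.
rewrite /loc [RHS](esym (Localization.pi_add _ _)).
apply/Localization.mkfrac_eq; exists 1; first exact: Localization.one_notin.
by rewrite /= !mulr1 mul1r subrr.
Qed.

Lemma locM a b : loc (a * b) = loc a * loc b.
Proof.
rewrite /loc [RHS](esym (Localization.pi_mul _ _)).
apply/Localization.mkfrac_eq; exists 1; first exact: Localization.one_notin.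
by rewrite /= !mulr1 mul1r subrr.
Qed.

Lemma loc0 : loc 0 = 0. Proof. by []. Qed.
Lemma loc1 : loc 1 = 1. Proof. by []. Qed.
Lemma locN a : loc (- a) = - loc a.
Proof. by apply/eqP; rewrite -addr_eq0 -locD addNr. Qed.

Lemma loc_sum I (r : seq I) (P : pred I) (f : I -> R) :
  loc (\sum_(i <- r | P i) f i) = \sum_(i <- r | P i) loc (f i).
Proof. exact: (big_morph _ locD loc0). Qed.

Lemma loc_prod I (r : seq I) (P : pred I) (f : I -> R) :
  loc (\prod_(i <- r | P i) f i) = \prod_(i <- r | P i) loc (f i).
Proof. exact: (big_morph _ locM loc1). Qed.

Lemma loc_inv s : s \notin irrelevant -> exists u, loc s * u = 1.
Proof.
move=> hs; exists (Localization.mkfrac 1 hs).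
rewrite /loc [LHS](esym (Localization.pi_mul _ _)) -loc1.
apply/Localization.mkfrac_eq; exists 1; first exact: Localization.one_notin.
by rewrite /= !mulr1 !mul1r subrr.
Qed.

Lemma mkfracE a s (hs : s \notin irrelevant) :
  loc s * Localization.mkfrac a hs = loc a.
Proof.
rewrite /loc [LHS](esym (Localization.pi_mul _ _)).
apply/Localization.mkfrac_eq; exists 1; first exact: Localization.one_notin.
by rewrite /= !mulr1 !mul1r mulrC subrr.
Qed.

Lemma loc_surj (z : A) :
  exists a s u, [/\ s \notin irrelevant, loc s * u = 1 & z = loc a * u].
Proof.
have [a [s [hs ->]]] := Localization.mkfrac_surj z.
have [u su] := loc_inv hs; exists a, s, u; split=> //.
by rewrite -(mkfracE a hs) mulrAC su mul1r.
Qed.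

Lemma jacobson_irrelevant a u : a \in irrelevant -> jacobson (loc a * u).
Proof.
move=> ha r.
have [b [s [v [hs sv ruE]]]] := loc_surj (r * u).
have hd : s - b * a \notin irrelevant.
  apply: contra hs => hs; rewrite -[s](subrK (b * a)).
  by apply: rpredD => //; exact: idealMr.
have [w hw] := loc_inv hd; exists (loc s * w).
rewrite [r * _]mulrCA ruE mulrA -[RHS]hw; congr (_ * _).
rewrite locD locN locM mulrBl mul1r; congr (_ - _).
have -> : loc a * (loc b * v) * loc s = loc b * loc a * (loc s * v) by ring.
by rewrite sv mulr1.
Qed.

Lemma loc_unit_or (z : A) :
  (exists w, z * w = 1) \/ exists w, (1 - z) * w = 1.
Proof.
have [a [s [u [hs su ->]]]] := loc_surj z.
have [ha|ha] := boolP (a \in irrelevant).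
  by right; have [w] := jacobson_irrelevant u ha 1; rewrite mul1r; exists w.
left; have [w aw] := loc_inv ha; exists (w * loc s).
by rewrite mulrACA aw mul1r mulrC.
Qed.

Lemma loc_proper (M : {pred A}) z : idealr_closed M -> z \in M ->
  exists2 a, a \in irrelevant & exists u, z = loc a * u.
Proof.
move=> [M0 M1 MD] zM; have [a [s [u [hs su zE]]]] := loc_surj z.
exists a; last by exists u.
apply: contraNT M1 => /loc_inv[w aw].
have := MD (w * loc s) _ _ zM M0; congr (_ \in M).
by rewrite zE addr0 mulrACA [w * _]mulrC aw mul1r.
Qed.

Section LocalizedRestriction.
Variable F : {set G}.
Hypothesis indF : independent F.

Lemma restr_neq0 s : s \notin irrelevant -> restr F s != 0.
Proof.
apply: contra => /eqP s0; rewrite irrelevantE.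
by apply/eqP; apply: restr_sub s0; rewrite ?sub0set ?independent0.
Qed.

Lemma loc_eq0 a : loc a = 0 -> restr F a = 0.
Proof.
rewrite -loc0 => /Localization.mkfrac_eq[u hu]; rewrite !mulr1 subr0 => ua.
have /eqP := restrM indF u a; rewrite ua restr0 // eq_sym mulf_eq0.
by rewrite (negPf (restr_neq0 hu)) => /eqP.
Qed.

Definition loc_prime : {pred A} :=
  fun z => `[< exists a s (hs : s \notin irrelevant),
                 z = Localization.mkfrac a hs /\ restr F a = 0 >].

Lemma loc_primeE a s u : s \notin irrelevant -> loc s * u = 1 ->
  (loc a * u \in loc_prime) = (restr F a == 0).
Proof.
move=> hs su.
have uE : loc a * u = Localization.mkfrac a hs.
  by rewrite -(mkfracE a hs) mulrAC su mul1r.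
apply/asboolP/eqP => [[b [t [ht [E b0]]]]|a0]; last by exists a, s, hs.
have : loc (a * t - b * s) = 0.
  rewrite locD locN !locM -(mkfracE b ht) -E.
  have -> : loc t * (loc a * u) * loc s = loc a * loc t * (loc s * u) by ring.
  by rewrite su mulr1 subrr.
move=> /loc_eq0/eqP; rewrite restrB // !restrM // b0 mul0r subr0 mulf_eq0.
by rewrite (negPf (restr_neq0 ht)) orbF => /eqP.
Qed.

Lemma loc_primeP z : exists a s u,
  [/\ s \notin irrelevant, loc s * u = 1, z = loc a * u
    & (z \in loc_prime) = (restr F a == 0)].
Proof.
have [a [s [u [hs su ->]]]] := loc_surj z.
by exists a, s, u; split=> //; exact: (loc_primeE a hs su).
Qed.

Lemma loc_primeE1 a : (loc a \in loc_prime) = (restr F a == 0).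
Proof.
rewrite -[loc a]mulr1; apply: (loc_primeE a (Localization.one_notin _)).
by rewrite loc1 mulr1.
Qed.

Lemma loc_prime_prime : prime_ideal loc_prime.
Proof.
split; first split.
- by rewrite -loc0 loc_primeE1 restr0.
- by rewrite -loc1 loc_primeE1 restr1 // oner_eq0.
- move=> r x y; have [c [p [q [hp pq -> _]]]] := loc_primeP r.
  have [a [s [u [hs su -> ->]]]] := loc_primeP x.
  have [b [t [v [ht tv -> ->]]]] := loc_primeP y => /eqP a0 /eqP b0.
  have -> : loc c * q * (loc a * u) + loc b * v =
      loc (c * a * t + b * (p * s)) * (q * u * v).
    rewrite locD !locM mulrDl.
    have -> : loc c * loc a * loc t * (q * u * v) =
      loc c * q * (loc a * u) * (loc t * v) by ring.
    have -> : loc b * (loc p * loc s) * (q * u * v) =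
      loc b * v * (loc p * q) * (loc s * u) by ring.
    by rewrite tv pq su !mulr1.
  have hpst : p * s * t \notin irrelevant by rewrite !Localization.mul_notin.
  rewrite (loc_primeE _ hpst); first by rewrite restrD // !restrM // a0 b0 !(mulr0, mul0r) addr0.
  have -> : loc (p * s * t) * (q * u * v) = (loc p * q) * (loc s * u) * (loc t * v).
    by rewrite !locM; ring.
  by rewrite pq su tv !mulr1.
- move=> x y; have [a [s [u [hs su -> ->]]]] := loc_primeP x.
  have [b [t [v [ht tv -> ->]]]] := loc_primeP y.
  rewrite mulrACA -locM (loc_primeE _ (Localization.mul_notin hs ht)).
    by rewrite restrM // mulf_eq0.
  by rewrite locM mulrACA su tv mulr1.
Qed.

End LocalizedRestriction.

Lemma prime_chain_independent (F : {set G}) :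
  independent F -> prime_chain A #|F|.
Proof.
move=> indF; pose E (i : 'I_#|F|.+1) : {set G} := [set v in take (#|F| - i) (enum F)].
have EF i : E i \subset F.
  by apply/subsetP => v; rewrite inE => /mem_take; rewrite mem_enum.
have indE i : independent (E i).
  apply/forall_inP => v /(subsetP (EF i)) vF; apply/forall_inP => w /(subsetP (EF i)) wF.
  exact: forall_inP (forall_inP indF v vF) w wF.
exists (fun i => loc_prime (E i)); split=> [i|i j ij]; first exact: loc_prime_prime.
have Eji : E j \subset E i.
  apply/subsetP => v; rewrite !inE; apply: mem_subseq.
  rewrite -(take_takel (enum F) (leq_sub2l #|F| (ltnW ij))); exact: take_subseq.
split=> [z|].
  have [a [s [u [hs su -> ->]]]] := loc_primeP (indE i) z.
  by rewrite (loc_primeE (indE j) a hs su) => /eqP/(restr_sub (indE i) (indE j) Eji) ->.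
have jF : (j <= #|F|)%N by rewrite -ltnS.
have ltF : (#|F| - j < #|F|)%N by rewrite ltn_subrL; lia.
have /card_gt0P[x0 _] : (0 < #|F|)%N by lia.
pose v := nth x0 (enum F) (#|F| - j).
have vE k : (v \in E k) = (#|F| - j < #|F| - k)%N.
  by rewrite inE in_take ?mem_nth ?index_uniq -?cardE ?enum_uniq.
move=> sub; have := sub (loc (evar v)).
rewrite !loc_primeE1 // !restr_evar // !vE ltnn eqxx => /(_ isT).
by rewrite (_ : (_ < _)%N) ?(negPf (vertex_var_neq0 v)) //; lia.
Qed.



(** * Connectedness in codimension one *)

Definition facet (F : {set G}) : bool := maxset (@independent G) F.

Lemma facet_independent (F : {set G}) : facet F -> independent F.
Proof. exact: maxsetp. Qed.

Lemma leq_alpha (F : {set G}) : independent F -> (#|F| <= alpha G)%N.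
Proof. by move=> indF; apply: (leq_bigmax_cond (F := fun F : {set G} => #|F|)). Qed.

Lemma alpha_max : exists2 F : {set G}, independent F & #|F| = alpha G.
Proof.
have [|F indF aE] := @eq_bigmax_cond _ (@independent G) (fun F : {set G} => #|F|).
  by apply/card_gt0P; exists set0; exact: independent0.
by exists F.
Qed.

Lemma cohen_macaulay_regular_seq : cohen_macaulay_graph K G ->
  noetherian A /\ exists s : seq A,
    [/\ (alpha G <= size s)%N, regular_seq s
      & forall z, z \in s -> exists2 a, a \in irrelevant & exists u, z = loc a * u].
Proof.
case=> _ /(_ irrelevant irrelevant_maximal)[noeth [M [[idM _] _]]].
case=> d [[[s [sd sM reg]] _] [_ dmax]]; split=> //; exists s; split=> //.
  have [F indF <-] := alpha_max.
  by rewrite sd; apply/dmax/prime_chain_independent.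
by move=> z /sM; apply: loc_proper.
Qed.

(* The elementary symmetric functions of degree 1, ..., [alpha - 2] cut down the
   quotient by [I + J] to dimension 0, since [I + J] contains every squarefree
   monomial of degree at least [alpha - 1]. *)
Lemma facet_codim1 (P : pred {set G}) F1 F2 :
  cohen_macaulay_graph K G -> facet F1 -> facet F2 -> P F1 -> ~~ P F2 ->
  exists F F', [/\ facet F, facet F', P F, ~~ P F' & (alpha G <= #|F :&: F'|.+1)%N].
Proof.
move=> /cohen_macaulay_regular_seq[noeth [s [le_s reg sm]]] f1 f2 P1 P2.
apply: contrapT => noadj.
pose NI (S : {set G}) := [forall F, facet F && P F ==> ~~ (S \subset F)].
pose NJ (S : {set G}) := [forall F, facet F && ~~ P F ==> ~~ (S \subset F)].
have lt2 : (1 < alpha G)%N.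
  rewrite ltnNge; apply/negP => le1; case: noadj.
  by exists F1, F2; split=> //; exact: leq_trans le1 _.
pose l := enum [pred S | NI S || NJ S].
have large (S : {set G}) : (alpha G <= #|S|.+1)%N -> S \in l.
  move=> leS; rewrite mem_enum inE; apply/norP.
  rewrite !negb_forall => -[/existsP[F]].
  rewrite negb_imply negbK => /andP[/andP[fF PF] SF] /existsP[F'].
  rewrite negb_imply negbK => /andP[/andP[fF' PF'] SF']; case: noadj.
  exists F, F'; split=> //; apply: leq_trans leS _; rewrite ltnS subset_leq_card //.
  by rewrite subsetI SF SF'.
have prod0 (S T : {set G}) : NI S -> NJ T -> loc (emon S) * loc (emon T) = 0.
  move=> /forallP nS /forallP nT; rewrite -locM emon_dependent ?loc0 //.
  apply/negP => /maxset_exists[F fF]; rewrite subUset => /andP[SF TF].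
  have := nS F; have := nT F; rewrite /facet fF SF TF /=.
  by case: (P F).
pose esym j : R := \sum_(S : {set G} | #|S| == j) emon S.
pose ys := [seq loc (esym j) | j <- iota 1 (alpha G - 2)].
have esymN j : (0 < j)%N -> esym j \in irrelevant.
  move=> j0; apply: rpred_sum => S /eqP cS.
  have /card_gt0P[v vS] : (0 < #|S|)%N by rewrite cS.
  rewrite /emon (bigD1 v vS) /= mulrC; apply: idealMr; exact: evar_irrelevant.
have [||||e he] := @regular_seq_multiplier A _ (fun S => loc (emon S))
   (fun S => if NI S then loc (emon S) else 0) l ys s noeth _ reg.
- move=> y /mapP[j]; rewrite mem_iota => /andP[j0 _] ->.
  by rewrite -[loc _]mulr1; apply/jacobson_irrelevant/esymN.
- by rewrite size_map size_iota subnK.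
- move=> z /sm[a ha [u ->]]; rewrite mulrC.
  have subr := submodule_radical (ys ++ [seq loc (emon S) | S <- l]).
  apply: (submoduleZ subr u).
  apply: (@irrelevant_sub (fun a => radical_span _ (loc a))) ha.
    split; first by rewrite loc0; exact: subr.1.
    by move=> c x y Nx Ny; rewrite /GRing.scale /= locD locM; apply: subr.2.
  move=> v; exists #|G|.
  have sub := submodule_span (ys ++ [seq loc (emon S) | S <- l]).
  apply: (exp_card_elementary (x := fun v => loc (evar v)) sub) => j j0.
  have -> : \sum_(S : {set G} | #|S| == j) \prod_(w in S) loc (evar w) = loc (esym j).
    by rewrite loc_sum; apply: eq_bigr => S _; rewrite loc_prod.
  have [jle|jgt] := leqP j (alpha G - 2).
    apply: mem_span; rewrite mem_cat; apply/orP; left.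
    by apply: (map_f (fun j => loc (esym j))); rewrite mem_iota j0; lia.
  rewrite loc_sum; apply: big_ind => [||S /eqP cS]; first exact: sub.1.
    by move=> *; apply: (submoduleD sub).
  apply: mem_span; rewrite mem_cat; apply/orP; right.
  by apply: (map_f (fun S => loc (emon S))); apply: large; lia.
- move=> S T; rewrite !mem_enum !inE => hS hT.
  case: ifP hT => [IT _|IT /= JT]; case: ifP hS => [IS _|IS /= JS]; rewrite ?mulr0 //.
  + exact: mulrC.
  + by rewrite mulrC prod0.
  + by rewrite mulrC prod0.
have NI2 : NI F2.
  apply/forallP => F; apply/implyP => /andP[fF PF]; apply: contra P2 => sF.
  by rewrite -(maxsetsup f2 (facet_independent fF) sF).
have NJ1 : NJ F1.
  apply/forallP => F; apply/implyP => /andP[fF PF]; apply: contra PF => sF.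
  by rewrite (maxsetsup f1 (facet_independent fF) sF).
have NI1 : NI F1 = false.
  by apply/negP => /forallP/(_ F1); rewrite f1 P1 subxx.
have nz F : facet F -> loc (emon F) <> 0.
  move=> /facet_independent indF /(loc_eq0 indF)/eqP.
  by apply/negP/restr_emon.
have e1 := he F1; have e2 := he F2.
rewrite mem_enum inE NJ1 NI1 in e1; rewrite mem_enum inE NI2 in e2.
have {}e1 := e1 isT; have {}e2 := e2 isT.
have [[w ew]|[w ew]] := loc_unit_or e.
- by apply: (nz F1) => //; rewrite -[loc _]mul1r -ew mulrAC -e1 mul0r.
- apply: (nz F2) => //; rewrite -[loc _]mul1r -ew mulrAC mulrBl mul1r -e2.
  by rewrite subrr mul0r.
Qed.

End Restriction.


Section Matchings.
Variable G : sgraph.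

Definition codim1_connected : Prop :=
  forall (P : pred {set G}) F1 F2, facet F1 -> facet F2 -> P F1 -> ~~ P F2 ->
  exists F F', [/\ facet F, facet F', P F, ~~ P F' & alpha G <= #|F :&: F'|.+1].

Lemma independent_adj (F : {set G}) v w :
  independent F -> v \in F -> w \in F -> adj v w = false.
Proof. by move=> indF vF wF; apply/negbTE/(forall_inP (forall_inP indF v vF)). Qed.

Lemma clique_adj (Q : {set G}) v w :
  clique Q -> v \in Q -> w \in Q -> v != w -> adj v w.
Proof. by move=> clQ vQ wQ; apply/implyP/(forall_inP (forall_inP clQ v vQ)). Qed.

Lemma independent1 v : independent [set v : G].
Proof.
apply/forall_inP => x /set1P ->; apply/forall_inP => y /set1P ->.
by rewrite adj_irrefl.
Qed.

Lemma clique1 v : clique [set v : G].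
Proof.
apply/forall_inP => x /set1P ->; apply/forall_inP => y /set1P ->.
by rewrite eqxx.
Qed.

Lemma facet_card (F : {set G}) : codim1_connected -> facet F -> #|F| = alpha G.
Proof.
move=> conn fF; apply/eqP; rewrite eqn_leq leq_alpha ?facet_independent //=.
rewrite leqNgt; apply/negP => lt.
have [F0 indF0 cF0] := alpha_max G.
have [F1 f1 F01] := maxset_exists indF0.
have c1 : alpha G <= #|F1| by rewrite -cF0 subset_leq_card.
have [||E [F' [_ fF' /eqP -> F'F]]] := conn (pred1 F) F F1 fF f1; rewrite /= ?eqxx //.
  by apply: contraL lt => /eqP <-; rewrite -leqNgt.
move=> le; case/eqP: F'F; apply: (maxsetsup fF (facet_independent fF')).
have /eqP <- : F :&: F' == F by rewrite eqEcard subsetIl -ltnS (leq_trans lt).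
exact: subsetIr.
Qed.

Section Partite.
Variable r : nat.
Hypothesis conn : codim1_connected.
Hypothesis maxcliques : forall A : {set G}, maximal_clique A -> #|A| = r.

Lemma part_facet (V : 'I_r -> {set G}) i :
  (forall i, independent (V i)) -> \bigcup_i V i = [set: G] -> facet (V i).
Proof.
move=> indV covV; apply/maxsetP; split=> // B indB sVB; apply/eqP.
rewrite eqEsubset sVB andbT; apply/subsetP => v vB; apply: contraT => vV.
have [Q maxQ] := maxset_exists (clique1 v); rewrite sub1set => vQ.
pose c w := odflt i [pick j | w \in V j].
have cV w : w \in V (c w).
  rewrite /c; case: pickP => [j //|no].
  have : w \in \bigcup_i V i by rewrite covV inE.
  by case/bigcupP => j _; rewrite no.
have injc : {in Q &, injective c}.
  move=> x y xQ yQ cxy; apply/eqP; apply: contraT => xy.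
  have := clique_adj (maxsetp maxQ) xQ yQ xy.
  by rewrite (independent_adj (indV (c x))) // cxy.
have : i \in c @: Q.
  apply: contraT => ni; have : c @: Q \subset [set~ i].
    by apply/subsetP => j jQ; rewrite !inE; apply: contraNneq ni => <-.
  move=> /subset_leq_card; rewrite card_in_imset // (maxcliques maxQ).
  by rewrite cardsC1 card_ord; have := ltn_ord i; lia.
case/imsetP => w wQ ic; have wV : w \in V i by rewrite ic.
have vw : v != w by apply: contraNneq vV => ->.
have := clique_adj (maxsetp maxQ) vQ wQ vw.
by rewrite (independent_adj indB) // (subsetP sVB).
Qed.

Lemma card_partite : rpartite G r -> #|G| = alpha G * r.
Proof.
case=> V [indV disV covV].
have fV i := part_facet i indV covV.
rewrite -cardsT -covV.
have -> : #|\bigcup_i V i| = \sum_i #|V i|.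
  apply/esym/eqP; rewrite -sum1_card.
  rewrite (eq_bigr (fun i => \sum_(v in V i) 1)) => [|i _]; last by rewrite sum1_card.
  by rewrite partition_disjoint_bigcup //.
by rewrite (eq_bigr (fun=> alpha G)) => [|i _]; rewrite ?facet_card // sum_nat_const card_ord mulnC.
Qed.

Lemma perfect_rmatching_exists :
  rpartite G r -> class_G G -> exists M : {set {set G}}, perfect_rmatching r M.
Proof.
move=> /card_partite cG [Q [clQ covQ]].
pose Q' i := s2val (maxset_exists (clQ i)).
have maxQ' i : maximal_clique (Q' i) by rewrite /Q'; case: maxset_exists.
have QQ' i : Q i \subset Q' i by rewrite /Q'; case: maxset_exists.
exists [set Q' i | i in 'I_(alpha G)]; set M := [set _ | _ in _].
have covM : cover M == [set: G].
  rewrite eqEsubset subsetT -covQ; apply/bigcupsP => i _.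
  apply: subset_trans (QQ' i) _; apply: (bigcup_sup (Q' i)).
  exact: imset_f.
have sizeM A : A \in M -> rclique r A.
  case/imsetP => i _ ->; rewrite /rclique (maxsetp (maxQ' i)).
  by rewrite (maxcliques (maxQ' i)) eqxx.
rewrite /perfect_rmatching /rmatching covM andbT; apply/andP; split.
  rewrite -(leq_card_cover M).2 eqn_leq (leq_card_cover M).1 /=.
  rewrite (eqP covM) cardsT cG (eq_bigr (fun=> r)) => [|A /sizeM/andP[_ /eqP] //].
  rewrite sum_nat_const leq_mul2r; apply/orP; right.
  by apply: leq_trans (leq_imset_card _ _) _; rewrite card_ord.
by apply/forall_inP => A; exact: sizeM.
Qed.

Section Colouring.
Variable M : {set {set G}}.
Hypothesis cardG : #|G| = alpha G * r.
Hypothesis r_gt0 : 0 < r.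
Hypothesis perfM : perfect_rmatching r M.

Lemma pblock_matching v : (v \in pblock M v) * (pblock M v \in M).
Proof.
have /andP[_ /eqP cov] := perfM.
by rewrite mem_pblock pblock_mem cov inE.
Qed.

Lemma rclique_matching A : A \in M -> clique A /\ #|A| = r.
Proof.
by have /andP[/andP[_ /forall_inP cl] _] := perfM => /cl/andP[? /eqP].
Qed.

Lemma card_matching : #|M| = alpha G.
Proof.
have /andP[/andP[triv _] /eqP cov] := perfM.
have := (leq_card_cover M).2; rewrite triv cov cardsT cardG.
rewrite (eq_bigr (fun=> r)) => [|A /rclique_matching[] //].
by rewrite sum_nat_const eqn_pmul2r // => /eqP.
Qed.

Lemma pblock_inj (F : {set G}) : facet F -> {in F &, injective (pblock M)}.
Proof.
move=> fF v w vF wF vw; apply/eqP; apply: contraT => ne.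
have [cl _] := rclique_matching (pblock_matching v).2.
have := clique_adj cl (pblock_matching v).1 _ ne; rewrite vw => /(_ (pblock_matching w).1).
by rewrite (independent_adj (facet_independent fF)).
Qed.

Lemma pblock_onto (F : {set G}) v : facet F -> exists2 u, u \in F & pblock M u = pblock M v.
Proof.
move=> fF; have sub : pblock M @: F \subset M.
  by apply/subsetP => _ /imsetP[u _ ->]; exact: (pblock_matching u).2.
have /eqP eqM : pblock M @: F == M.
  rewrite eqEcard sub (card_in_imset (pblock_inj fF)) facet_card //.
  by rewrite card_matching /= leqnn.
have : pblock M v \in pblock M @: F by rewrite eqM (pblock_matching v).2.
by case/imsetP => u uF ->; exists u.
Qed.

End Colouring.

Lemma perfect_rmatching_sub (M N : {set {set G}}) :
  #|G| = alpha G * r -> 0 < r ->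
  perfect_rmatching r M -> perfect_rmatching r N -> M \subset N.
Proof.
move=> cG r0 pM pN.
have [F0 f0 _] := maxset_exists (independent0 G).
pose P (F : {set G}) := [forall v in F, forall w in F0,
  (pblock M v == pblock M w) ==> (pblock N v == pblock N w)].
have PP F v w : P F -> v \in F -> w \in F0 -> pblock M v = pblock M w -> pblock N v = pblock N w.
  move=> PF vF wF0 E; apply/eqP.
  by have := forall_inP (forall_inP PF v vF) w wF0; rewrite E eqxx.
have P0 : P F0.
  apply/forall_inP => v vF; apply/forall_inP => w wF; apply/implyP => /eqP E.
  by rewrite (pblock_inj pM f0 vF wF E).
have allP F : facet F -> P F.
  move=> fF; apply: contraT => nPF.
  have [E [F' [fE fF' PE nPF' le]]] := conn f0 fF P0 nPF.
  case/negP: nPF'; apply/forall_inP => v vF'; apply/forall_inP => w wF0.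
  apply/implyP => /eqP vw.
  have [u uE uv] := pblock_onto cG r0 pM v fE.
  have [u' u'E u'v] := pblock_onto cG r0 pN v fE.
  suff -> : pblock N v = pblock N u by apply/eqP/(PP E); rewrite ?uv.
  have [vE|vE] := boolP (v \in E).
    by rewrite (pblock_inj pM fE uE vE uv).
  have uF' : u \notin F'.
    by apply: contra vE => uF'; rewrite -(pblock_inj pM fF' uF' vF' uv).
  have u'F' : u' \notin F'.
    by apply: contra vE => u'F'; rewrite -(pblock_inj pN fF' u'F' vF' u'v).
  have : #|E :\: F'| <= 1.
    by rewrite cardsD (facet_card conn fE) leq_subLR addn1.
  move=> /card_le1_eqP /(_ u u'); rewrite !inE uE u'E uF' u'F' => <- //.
apply/subsetP => A AM.
have [clA cA] := rclique_matching pM AM.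
have /card_gt0P[v vA] : 0 < #|A| by rewrite cA.
have trivM : trivIset M by case/andP: pM => /andP[].
have AE w : w \in A -> pblock M w = A by move=> wA; apply: def_pblock.
suff -> : A = pblock N v by exact: (pblock_matching pN v).2.
have [_ cN] := rclique_matching pN (pblock_matching pN v).2.
apply/eqP; rewrite eqEcard cA cN leqnn andbT; apply/subsetP => w wA.
suff <- : pblock N w = pblock N v by exact: (pblock_matching pN w).1.
have [u uF0 uA] := pblock_onto cG r0 pM v f0.
have key x : x \in A -> pblock N x = pblock N u.
  move=> xA; have [F fF] := maxset_exists (independent1 x); rewrite sub1set => xF.
  by apply: (PP F) => //; [exact: allP|rewrite uA !AE].
by rewrite !key.
Qed.

End Partite.
End Matchings.

Theorem corollary3p6 (K : fieldType) (r : nat) (G : sgraph)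
  (r_ge1 : 1 <= r)
  (G_nonempty : 0 < #|G|)
  (G_rpartite : rpartite G r)
  (G_class : class_G G)
  (G_maxcliques : forall A : {set G}, maximal_clique A -> #|A| = r)
  (G_CM : cohen_macaulay_graph K G) :
  exists! M : {set {set G}}, perfect_rmatching r M.
Proof.
have conn : codim1_connected G by move=> P F1 F2; exact: facet_codim1 G_CM.
have cG := card_partite conn G_maxcliques G_rpartite.
have [M pM] := perfect_rmatching_exists conn G_maxcliques G_rpartite G_class.
exists M; split=> // N pN.
by apply/eqP; rewrite eqEsubset !(perfect_rmatching_sub conn cG).
Qed.
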